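(* Let $d\geq 2$ and let $A\subseteq\mathbb{R}^d$ be an affine coordinate subspace of dimension $k\geq 2$. Then $A$ is of Khintchine type for divergence: for every nonincreasing function $\psi:\mathbb{N}\to\mathbb{R}^+$ such that $\sum_{q\in\mathbb{N}}\psi(q)^d$ diverges, $k$-dimensional Lebesgue measure almost every point of $A$ is $\psi$-approximable.
   Context: An affine coordinate subspace of $\mathbb{R}^d$ of dimension $k$ is a set obtained from one of the form $\{\mathbf{x}\}\times\mathbb{R}^k$, with $\mathbf{x}\in\mathbb{R}^\ell$ and $\ell+k=d$, by a permutation of the coordinates; i.e. the set of points whose coordinates in some fixed set of $\ell$ positions take prescribed values, the other $k$ coordinates being arbitrary. For $\mathbf{y}\in\mathbb{R}^d$, $\|\mathbf{y}\|$ denotes the sup-norm distance from $\mathbf{y}$ to the nearest point of $\mathbb{Z}^d$. Given $\psi:\mathbb{N}\to\mathbb{R}^+$, a vector $\mathbf{y}\in\mathbb{R}^d$ is called $\psi$-approximable if there are infinitely many $q\in\mathbb{N}$ with $\|q\mathbf{y}\|<\psi(q)$. ''Almost every point'' of $A$ refers to the $k$-dimensional Lebesgue measure on $A$. *)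

(* Defs.v *)
From HB Require Import structures.
From mathcomp Require Import all_boot all_order all_algebra.
From mathcomp Require Import all_classical all_reals all_analysis.

Set Implicit Arguments.
Unset Strict Implicit.
Unset Printing Implicit Defensive.

Import Order.TTheory GRing.Theory Num.Theory.
Import numFieldNormedType.Exports.

Local Open Scope classical_set_scope.
Local Open Scope ring_scope.

(* Points of R^n are n-tuples: these, unlike row vectors, carry the product
   sigma-algebra in MathComp-Analysis. *)

(* [pushforward] bundled with its measure structure; the canonical instance
   cannot be inferred since it depends on the proof [mf]. *)
Definition pushforward_measure d1 d2 (T1 : measurableType d1)
    (T2 : measurableType d2) (R : realType) (m : {measure set T1 -> \bar R})
    (f : T1 -> T2) (mf : measurable_fun [set: T1] f) :
    {measure set T2 -> \bar R} :=
  measure_function_pushforward__canonical__measure_function_Measure m mf.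

Section lebesgue_tuple.
Context {R : realType}.
Local Open Scope ereal_scope.

Definition pair_tuple n (p : n.-tuple R * R) : n.+1.-tuple R :=
  [tuple of p.2 :: p.1].

Lemma measurable_pair_tuple n :
  measurable_fun [set: n.-tuple R * R] (@pair_tuple n).
Proof.
exact: (@measurable_cons _ _ _ _ snd n fst measurable_snd measurable_fst).
Qed.

(* n-dimensional Lebesgue measure on R^n, as an iterated product of
   [lebesgue_measure]. *)
Fixpoint lebesgue_tuple n : {measure set (n.-tuple R) -> \bar R} :=
  match n with
  | 0 => \d_([tuple] : 0.-tuple R)
  | n'.+1 => pushforward_measure (lebesgue_tuple n' \x @lebesgue_measure R)
               (@measurable_pair_tuple n')
  end.

Lemma lebesgue_tuple_box n (B : 'I_n -> set R) :
  (forall i, measurable (B i)) ->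
  lebesgue_tuple n [set t | forall i, B i (tnth t i)] =
  \prod_(i < n) lebesgue_measure (B i).
Proof.
elim: n B => [|n IH] B mB.
  by rewrite big_ord0 /= diracE mem_set//= => -[].
have mbox : measurable
    [set t : n.-tuple R | forall i, B (lift ord0 i) (tnth t i)].
  rewrite (_ : mkset _ = \bigcap_(i in [set: 'I_n])
      ((@tnth n R ^~ i) @^-1` B (lift ord0 i))); last first.
    by apply/seteqP; split => [t /= tB i _|t tB i]; exact: tB.
  apply: (@fin_bigcap_measurable _ (n.-tuple R : measurableType _)) => // i _.
  rewrite -[X in measurable X]setTI.
  exact: measurable_tnth.
transitivity ((lebesgue_tuple n \x @lebesgue_measure R)
    ([set t : n.-tuple R | forall i, B (lift ord0 i) (tnth t i)] `*` B ord0)).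
  apply: (congr1 (lebesgue_tuple n \x @lebesgue_measure R)).
  apply/seteqP; split => -[t x] /=.
    move=> tB; split => [i|]; last exact: (tB ord0).
    by move: (tB (lift ord0 i)); rewrite tnthS.
  move=> [tB xB] i; case: (unliftP ord0 i) => [j ->|-> //].
  by rewrite tnthS; exact: tB.
rewrite (product_measure1E (lebesgue_tuple n) (@lebesgue_measure R) mbox);
  last exact: (mB ord0).
by rewrite big_ord_recl muleC (IH (fun i => B (lift ord0 i)))//.
Qed.

End lebesgue_tuple.

(* [fixed_value] is only relevant at the positions in [fixed]. *)
Record coord_subspace (R : realType) (d k : nat) := CoordSubspace {
  fixed : {set 'I_d};
  fixed_value : 'I_d -> R;
  fixed_card : (#|fixed| + k)%N = d }.

Section coord_subspace.
Context {R : realType} {d k : nat}.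
Implicit Types (A : coord_subspace R d k).

Definition coord_set A : set (d.-tuple R) :=
  [set y | forall i, i \in fixed A -> tnth y i = fixed_value A i].

(* The bijection from R^k to A that inserts the k parameters, in order, at the
   positions outside [fixed A]. *)
Definition coord_param A (t : k.-tuple R) : d.-tuple R :=
  [tuple if i \in fixed A then fixed_value A i
         else nth 0 t (index i (enum (~: fixed A))) | i < d].

Lemma card_free A : #|~: fixed A| = k.
Proof.
by apply/eqP; rewrite -(eqn_add2l #|fixed A|) cardsC card_ord fixed_card.
Qed.

Lemma range_coord_param A : range (coord_param A) = coord_set A.
Proof.
apply/seteqP; split => [_ [t _ <-] i iA|y yA].
  by rewrite tnth_mktuple iA.
pose s := [seq tnth y i | i <- enum (~: fixed A)].
have ss : size s == k by rewrite size_map -cardE card_free.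
exists (Tuple ss) => //; apply: eq_from_tnth => i; rewrite tnth_mktuple.
case: ifPn => iA; first by rewrite yA.
have iF : i \in enum (~: fixed A) by rewrite mem_enum inE.
by rewrite /= (nth_map i) ?index_mem// nth_index.
Qed.

Lemma coord_param_inj A : injective (coord_param A).
Proof.
move=> t u tu; apply: eq_from_tnth => j.
have sk : size (enum (~: fixed A)) = k by rewrite -cardE card_free.
have [x0 _] : exists x0 : 'I_d, true.
  case: (enum _) sk => [k0|x0 _ _]; last by exists x0.
  by case: j => j jk; move: (jk); rewrite -k0.
pose i := nth x0 (enum (~: fixed A)) j.
have iF : i \in enum (~: fixed A) by rewrite mem_nth// sk.
have iA : i \in fixed A = false.
  by apply/negbTE; move: iF; rewrite mem_enum inE.
move: (congr1 (fun y => tnth y i) tu); rewrite !tnth_mktuple iA.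
by rewrite index_uniq ?enum_uniq ?sk// -!tnth_nth.
Qed.

Lemma measurable_coord_param A : measurable_fun setT (coord_param A).
Proof.
apply/measurable_fun_tnthP => i /=.
have [iA|iA] := boolP (i \in fixed A).
  apply: (eq_measurable_fun (cst (fixed_value A i))) => //.
  by move=> t _; rewrite /= tnth_mktuple iA.
have ik : (index i (enum (~: fixed A)) < k)%N.
  by rewrite -{2}(card_free A) cardE index_mem mem_enum inE.
apply: (eq_measurable_fun (@tnth k R ^~ (Ordinal ik))).
  by move=> t _; rewrite /= tnth_mktuple (negbTE iA) (tnth_nth 0).
exact: measurable_tnth.
Qed.

(* k-dimensional Lebesgue measure on A, as a measure on R^d carried by A. *)
Definition coord_lebesgue A : {measure set (d.-tuple R) -> \bar R} :=
  pushforward_measure (lebesgue_tuple k) (measurable_coord_param A).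

End coord_subspace.

Section approximation.
Context {R : realType} {d : nat}.

(* The norm on row vectors is the sup norm. *)
Definition dist_Zd (v : 'rV[R]_d) : R :=
  inf [set `|v - map_mx intr p| | p in [set: 'rV[int]_d]].

Definition psi_approximable (psi : nat -> R) (y : d.-tuple R) : Prop :=
  infinite_set [set q : nat |
    (0 < q)%N /\ dist_Zd (q%:R *: \row_i tnth y i) < psi q].

(* The positive integers are the domain of psi; the value [psi 0] is unused. *)
Definition khintchine_type_divergence k (A : coord_subspace R d k) : Prop :=
  forall psi : nat -> R,
    (forall q, (0 < q)%N -> 0 < psi q) ->
    (forall p q, (0 < p)%N -> (p <= q)%N -> psi q <= psi p) ->
    ~ cvgn (fun n => \sum_(1 <= q < n) psi q ^+ d) ->
    {ae coord_lebesgue A, forall y, coord_set A y -> psi_approximable psi y}.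

End approximation.

(* Main.v *)
(* The argument is local and uses no zero-one law. In a cube of side 1/M with
   corner in (1/M)Z^k keep only the denominators q = M n; after rescaling, the
   problem becomes the original one on the unit cube, with psi(n) replaced by
   a(n) = min(psi(M n), tau) and the fixed coordinates x by M x.

   Dirichlet's pigeonhole argument gives at least 2^-l N a(N)^l - 1 integers
   n <= N with all n x_i within a(N) of an integer, for every x in R^l; summation
   by parts then turns the divergence of sum a(n)^(l+k) into that of sum a(n)^k
   over the n such that all n x_i are within a(n) of an integer.

   For such n take the cubes of side a(n)/n cornered at the s/n with
   gcd(s, n) = 1. Since k >= 2 their union has measure at least a(n)^k/4.
   Primitivity forbids s/n = t/m for n <> m, which removes the gcd term from the
   overlap count and leaves an overlap of at most 3^k a(n)^k a(m)^k. By
   Bonferroni, a fixed proportion of every cube is covered. A closed set missing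
   a fixed proportion of every dyadic cube is null, as one sees by covering it
   with the dyadic cubes of side 2^-j that it meets and letting j go to
   infinity. *)
Require Import Defs.
From mathcomp Require Import all_boot all_order all_algebra.
From mathcomp Require Import all_classical all_reals all_analysis.
From mathcomp Require Import zify ring lra.

Set Implicit Arguments.
Unset Strict Implicit.
Unset Printing Implicit Defensive.

Import Order.TTheory GRing.Theory Num.Theory.
Import numFieldNormedType.Exports.

Local Open Scope ring_scope.

(* [gcd (s, n) = 1]; restricting [e] to [e <= n] matters only for [n = 0]. *)
Definition prim k n (s : {ffun 'I_k -> 'I_n}) :=
  [forall e : 'I_n.+1, (e %| n)%N && [forall i, (e %| s i)%N] ==> (e == 1 :> nat)].

(** * Counting primitive numerators and close pairs of fractions *)

Section arith.
Context {R : realType}.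

(** Since [e ^- 2 <= (e - 1)^-1 - e^-1], the sharper bound [3 / 4 - n^-1] for [n >= 2] survives
    induction, with equality at [n = 2]. A constant below [1] leaves a positive proportion of
    primitive numerators. *)
Lemma sum_invsq_le n : (0 < n)%N ->
  \sum_(2 <= e < n.+1) (e%:R ^- 2 : R) <= 3 / 4.
Proof.
case: n => // -[_|n _]; first by rewrite big_geq// divr_ge0.
suff: \sum_(2 <= e < n.+3) (e%:R ^- 2 : R) <= 3 / 4 - n.+2%:R^-1.
  by move=> /le_trans; apply; rewrite gerBl.
elim: n => [|n IH]; first by rewrite big_nat1; lra.
rewrite big_nat_recr//=; apply: le_trans (lerD IH (lexx _)) _.
have n0 : 0 < n%:R + 2 :> R by rewrite ltr_wpDl.
have -> : n.+3%:R = n%:R + 3 :> R by rewrite -natrD addn3.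
have -> : n.+2%:R = n%:R + 2 :> R by rewrite -natrD addn2.
rewrite -subr_ge0.
rewrite [X in 0 <= X](_ : _ = (n%:R + 2)^-1 * (n%:R + 3) ^- 2); last first.
  by field; rewrite !gt_eqF// ltr_wpDl.
by rewrite mulr_ge0 ?invr_ge0 ?exprn_ge0// ?addr_ge0.
Qed.

Lemma card_multiples n e : (0 < n)%N -> (e %| n)%N ->
  (#|[pred j : 'I_n | (e %| j)%N]| <= n %/ e)%N.
Proof.
move=> n0 en.
have e0 : (0 < e)%N by exact: dvdn_gt0 en.
have lt (j : 'I_n) : (j %/ e < n %/ e)%N.
  by rewrite ltn_divLR// divnK.
pose f (j : 'I_n) := Ordinal (lt j).
rewrite -[X in (_ <= X)%N]card_ord.
have fi : {in [pred j : 'I_n | (e %| j)%N] &, injective f}.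
  move=> i j; rewrite !inE => ei ej /(congr1 val)/= ij.
  by apply: val_inj; rewrite /= -(divnK ei) ij divnK.
by rewrite -(card_in_imset fi) max_card.
Qed.

(** A tuple that is not primitive has all its entries divisible by some divisor [e > 1] of [n].
    There are at most [(n / e) ^ k] such tuples, hence at most [n ^ k / e ^ 2] as [k >= 2]; summing
    over [e] leaves a quarter of all tuples. *)
Lemma card_prim k n : (2 <= k)%N -> (0 < n)%N ->
  n%:R ^+ k <= 4 * #|[set s : {ffun 'I_k -> 'I_n} | prim s]|%:R :> R.
Proof.
move=> k2 n0.
pose P := [set s : {ffun 'I_k -> 'I_n} | prim s].
pose F (e : nat) := [set s : {ffun 'I_k -> 'I_n} |
  (e %| n)%N && [forall i, (e %| s i)%N]].
have PC : (~: P \subset \bigcup_(e : 'I_n.+1 | (1 < e)%N) F e).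
  apply/fintype.subsetP => s; rewrite !inE => /forallPn[e]; rewrite negb_imply.
  move=> /andP[h e1]; apply/bigcupP; exists e; last by rewrite inE.
  have : (0 < e)%N by case/andP: h => /dvdn_gt0 ->.
  by case: (val e) e1 => // -[].
have cF e : (1 < e)%N -> #|F e|%:R <= n%:R ^+ k * e%:R ^- 2 :> R.
  move=> e1; have [en|en] := boolP (e %| n)%N; last first.
    rewrite (_ : F e = finset.set0) ?cards0 ?mulr_ge0 ?invr_ge0 ?exprn_ge0//.
    by apply/setP => s; rewrite !inE (negbTE en).
  have FE : #|F e| = (#|[pred j : 'I_n | (e %| j)%N]| ^ k)%N.
    rewrite -[X in (_ ^ X)%N]card_ord -card_ffun_on; apply: eq_card => s.
    by rewrite !inE en/=; apply/forallP/ffun_onP => h i; move: (h i); rewrite inE.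
  have : (#|F e| * e ^ 2 <= n ^ k)%N.
    rewrite FE -[X in (_ <= X ^ _)%N](divnK en) expnMn leq_mul//.
      by rewrite leq_exp2r ?card_multiples//; exact: ltnW.
    by rewrite leq_pexp2l// ltnW.
  rewrite ler_pdivlMr; last by rewrite exprn_gt0// ltr0n ltnW.
  by rewrite -!natrX -natrM ler_nat.
have cC : #|~: P|%:R <= 3 / 4 * n%:R ^+ k :> R.
  apply: (@le_trans _ _ (\sum_(e : 'I_n.+1 | (1 < e)%N) #|F e|%:R)).
    rewrite -natr_sum ler_nat; apply: leq_trans (subset_leq_card PC) _.
    elim/big_rec2 : _ => [|e a B _ IH]; first by rewrite cards0.
    by rewrite (leq_trans (leq_card_setU _ _))// leq_add2l.
  apply: (@le_trans _ _ (\sum_(e : 'I_n.+1 | (1 < e)%N) n%:R ^+ k * e%:R ^- 2)).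
    by apply: ler_sum => e e1; exact: cF.
  rewrite -mulr_sumr mulrC ler_wpM2r ?exprn_ge0//.
  apply: le_trans (sum_invsq_le n0).
  rewrite -(big_mkord (fun e => (1 < e)%N) (fun e => e%:R ^- 2 : R)).
  rewrite (@big_cat_nat _ _ _ 2)//= big_nat_cond big1 ?add0r.
    rewrite big_nat_cond [leRHS]big_nat_cond.
    rewrite (eq_bigl (fun i => (2 <= i < n.+1)%N && true))// => i.
    by rewrite andbT; case: (ltnP 1 i) => //; rewrite ?andbT ?andbF.
  by move=> i; lia.
have : (#|P| + #|~: P|)%:R = n%:R ^+ k :> R.
  by rewrite cardsC card_ffun !card_ord natrX.
by rewrite natrD -/P; lra.
Qed.

(** If [s / n = t / m], then [n / gcdn n m] divides [n] and, by Gauss, every [s i], so primitivity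
    makes it [1]; symmetrically for [m], whence [n = m]. *)
Lemma prim_neq k n m (s : {ffun 'I_k -> 'I_n}) (t : {ffun 'I_k -> 'I_m}) :
  (0 < n)%N -> (0 < m)%N -> prim s -> prim t -> n != m ->
  exists i, (s i * m != t i * n)%N.
Proof.
move=> n0 m0 sp tp nm; apply/existsP; apply: contra_neqT nm.
rewrite negb_exists => /forallP/= h.
have {}h i : (s i * m = t i * n)%N by apply/eqP; move: (h i); rewrite negbK.
have g0 : (0 < gcdn n m)%N by rewrite gcdn_gt0 n0.
have one a b (u : {ffun 'I_k -> 'I_a}) (v : {ffun 'I_k -> 'I_b}) :
    (0 < a)%N -> (0 < b)%N -> (forall i, (u i * b = v i * a)%N) -> prim u ->
    (a %/ gcdn a b = 1)%N.
  move=> a0 b0 uv up.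
  have g0' : (0 < gcdn a b)%N by rewrite gcdn_gt0 a0.
  have lt : (a %/ gcdn a b < a.+1)%N by rewrite ltnS leq_div.
  move/forallP : up => /(_ (Ordinal lt))/implyP/= h1; apply/eqP/h1.
  rewrite dvdn_div ?dvdn_gcdl//=; apply/forallP => i.
  have co : coprime (a %/ gcdn a b) (b %/ gcdn a b).
    rewrite /coprime -(eqn_pmul2r g0') muln_gcdl !divnK ?dvdn_gcdl ?dvdn_gcdr//.
    by rewrite mul1n.
  rewrite -(Gauss_dvdl _ co) -(dvdn_pmul2r g0') -mulnA !divnK ?dvdn_gcdl ?dvdn_gcdr//.
  by rewrite uv dvdn_mull.
have n1 := one n m s t n0 m0 h sp.
have m1 : (m %/ gcdn n m = 1)%N by rewrite gcdnC; apply: (one m n t s).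
by rewrite -(divnK (dvdn_gcdl n m)) n1 -{2}(divnK (dvdn_gcdr n m)) m1.
Qed.

(** With [n = n' * g] and [m = m' * g], the integer [s * m' - t * n'] takes at most [2 * L + 1]
    values, [L] being the integer part of [D / g]. Each value fixes [s] modulo [n'], so it occurs at
    most [g] times. The total is at most [2 * D + g], and [g < D]. *)
Lemma card_close_pairs n m (D : R) : (0 < n)%N -> (0 < m)%N ->
  (gcdn n m)%:R < D ->
  #|[set p : 'I_n * 'I_m | `|p.1%:R * m%:R - p.2%:R * n%:R| < D]|%:R <= 3 * D.
Proof.
move=> n0 m0; set g := gcdn n m => gD.
have g0 : (0 < g)%N by rewrite gcdn_gt0 n0.
have g0R : 0 < g%:R :> R by rewrite ltr0n.
pose n' := (n %/ g)%N; pose m' := (m %/ g)%N.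
have nE : n = (n' * g)%N by rewrite divnK ?dvdn_gcdl.
have mE : m = (m' * g)%N by rewrite divnK ?dvdn_gcdr.
have n'0 : (0 < n')%N by lia.
have m'0 : (0 < m')%N by lia.
have co : coprime n' m'.
  by rewrite /coprime -(eqn_pmul2r g0) muln_gcdl -nE -mE mul1n.
have D0 : 0 < D by exact: lt_trans gD.
pose L := Num.truncn (D / g%:R).
have LD : L%:R * g%:R <= D.
  by rewrite -ler_pdivlMr// truncn_le// divr_ge0// ltW.
have DL : D < L.+1%:R * g%:R by rewrite -ltr_pdivrMr// truncnS_gt.
pose P := [set p : 'I_n * 'I_m | `|p.1%:R * m%:R - p.2%:R * n%:R| < D].
have PL p : p \in P -> (p.1 * m' <= p.2 * n' + L)%N /\ (p.2 * n' <= p.1 * m' + L)%N.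
  rewrite inE => pD.
  have : `|p.1%:R * m'%:R - p.2%:R * n'%:R| < L.+1%:R :> R.
    rewrite -(ltr_pM2r g0R); apply: le_lt_trans DL; apply: ltW.
    rewrite -[X in _ * X]gtr0_norm// -normrM mulrBl -!mulrA -!natrM -mE -nE.
    by rewrite !natrM.
  rewrite ltr_norml => /andP[h1 h2]; split.
    rewrite -ltnS -addnS -(@ltr_nat R) natrD !natrM; lra.
  rewrite -ltnS -addnS -(@ltr_nat R) natrD !natrM; lra.
have lt1 (p : 'I_n * 'I_m) : (p.1 %/ n' < g)%N.
  by rewrite ltn_divLR// mulnC -nE.
(* The shift by [L] keeps the natural subtraction from truncating; the quotient by [n'] separates
   the values of [s] within one residue class. *)
pose f (p : 'I_n * 'I_m) : 'I_(2 * L).+1 * 'I_g :=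
  (inord (p.1 * m' + L - p.2 * n')%N, Ordinal (lt1 p)).
have fi : {in P &, injective f}.
  move=> [s t] [s' t'] /PL/= [h1 h2] /PL/= [h3 h4] [] /(congr1 val)/=.
  rewrite !inordK; [|lia|lia] => e1 e2.
  have e3 : (s * m' + t' * n' = s' * m' + t * n')%N by lia.
  have smod : (s = s' %[mod n'])%N.
    have : ((s * m') %% n' = (s' * m') %% n')%N.
      have := congr1 (modn ^~ n') e3.
      by rewrite -!(addnC (_ * n')%N) !modnMDl.
    have [u [v uv]] : exists u v, (m' * u = v * n' + 1)%N.
      have [u v uv _] := egcdnP n' m'0; exists u, v.
      by rewrite mulnC uv gcdnC (eqP co).
    move=> /(congr1 (fun z => (z * u) %% n'))%N; rewrite !modnMml -!mulnA uv.
    by rewrite !mulnDr !muln1 !mulnA !modnMDl.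
  have ss : s = s' :> nat by rewrite (divn_eq s n') (divn_eq s' n') e2 smod.
  have tt : t = t' :> nat.
    apply/eqP; rewrite -(eqn_pmul2r n'0); apply/eqP; move: e3; rewrite ss.
    by move=> /eqP; rewrite eqn_add2l => /eqP.
  by congr (_, _); exact: val_inj.
have : (#|P| <= (2 * L).+1 * g)%N.
  rewrite -(card_in_imset fi) (leq_trans (max_card _))//.
  by rewrite card_prod !card_ord.
rewrite -(@ler_nat R) natrM -addn1 natrD natrM => h; apply: le_trans h _.
by nra.
Qed.

End arith.

(** * Dirichlet's pigeonhole argument and summation by parts *)

Definition int_near {R : realType} (delta z : R) : bool :=
  `[< exists p : int, `|z - p%:~R| < delta >].

Section counting.
Context {R : realType}.

Lemma int_near_le (a b z : R) : a <= b -> int_near a z -> int_near b z.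
Proof.
by move=> ab /asboolP[p h]; apply/asboolP; exists p; exact: lt_le_trans h ab.
Qed.

(** The unit cube is cut into [K ^ #|I|] cells, and every cell is bounded: subtracting its least
    member sends the [q] of a cell injectively into the counted set, because fractional parts in one
    cell differ by less than [K^-1]. *)
Lemma pigeonhole_near (I : finType) (x : I -> R) N K : (0 < K)%N ->
  (N.+1 <= #|[set q : 'I_N.+1 | [forall i, int_near K%:R^-1 (q%:R * x i)]]|
             * K ^ #|I|)%N.
Proof.
case: K => // K _; set Z := [set q : 'I_N.+1 | _].
have K0 : 0 < K.+1%:R :> R by [].
pose fr (z : R) := z - (Num.floor z)%:~R.
have fr0 z : 0 <= fr z by rewrite subr_ge0 floor_le.
have fr1 z : fr z < 1 by rewrite ltrBlDl -intrD1 floorD1_gt.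
pose f (q : 'I_N.+1) : {ffun I -> 'I_K.+1} :=
  [ffun i => inord (Num.truncn (K.+1%:R * fr (q%:R * x i)))].
have class_le c : (#|[set q | f q == c]| <= #|Z|)%N.
  case: (set_0Vmem [set q | f q == c]) => [->|[q1 q1c]]; first by rewrite cards0.
  case: (@arg_minnP _ q1 (fun q => q \in [set q | f q == c]) val q1c).
  move=> q0 q0c q0min.
  have lt (q : 'I_N.+1) : (q - q0 < N.+1)%N.
    by rewrite (leq_ltn_trans (leq_subr _ _)).
  pose g q := Ordinal (lt q).
  have gi : {in [set q | f q == c] &, injective g}.
    move=> q q' qc q'c /(congr1 val)/= qq'; apply: val_inj => /=.
    by have := q0min _ qc; have := q0min _ q'c; move: qq' => /=; lia.
  rewrite -(card_in_imset gi); apply: subset_leq_card.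
  apply/fintype.subsetP => _ /imsetP[q qc ->]; rewrite inE.
  apply/forallP => i; apply/asboolP.
  exists (Num.floor (q%:R * x i) - Num.floor (q0%:R * x i)).
  rewrite /= natrB ?q0min// mulrBl intrB.
  rewrite (_ : _ - _ = fr (q%:R * x i) - fr (q0%:R * x i)); last first.
    by rewrite /fr; ring.
  have : Num.truncn (K.+1%:R * fr (q%:R * x i)) =
         Num.truncn (K.+1%:R * fr (q0%:R * x i)).
    move: qc q0c; rewrite !inE => /eqP <- /eqP.
    move=> /(congr1 (fun h : {ffun I -> 'I_K.+1} => val (h i))).
    have tlt z : (Num.truncn (K.+1%:R * fr z) < K.+1)%N.
      by rewrite truncn_lt_nat ?mulr_ge0// gtr_pMr.
    by rewrite !ffunE/= !inordK.
  have /truncn_itv := mulr_ge0 (ltW K0) (fr0 (q%:R * x i)).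
  have /truncn_itv := mulr_ge0 (ltW K0) (fr0 (q0%:R * x i)).
  move=> /andP[h1 h2] /andP[h3 h4] h5; rewrite h5 in h3 h4.
  move: h1 h2 h3 h4; move: (Num.truncn _) => t h1 h2 h3 h4.
  rewrite -(ltr_pM2l K0) mulfV ?gt_eqF// -[X in X * _]gtr0_norm// -normrM mulrBr.
  rewrite -(natr1 t) in h2; rewrite -(natr1 t) in h4.
  by rewrite ltr_norml; apply/andP; split; lra.
have NE : (N.+1 <= \sum_(c : {ffun I -> 'I_K.+1}) #|[set q | f q == c]|)%N.
  rewrite -[X in (X <= _)%N]card_ord -sum1_card (partition_big f predT)//=.
  apply: leq_sum => c _; rewrite -sum1_card.
  by apply: eq_leq; apply: eq_bigl => q; rewrite !inE.
apply: leq_trans NE _.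
apply: (@leq_trans (\sum_(c : {ffun I -> 'I_K.+1}) #|Z|)%N).
  by apply: leq_sum => c _; exact: class_le.
by rewrite sum_nat_const card_ffun card_ord mulnC.
Qed.

Lemma count_near (I : finType) (x : I -> R) N (delta : R) :
  0 < delta -> delta <= 1 ->
  N%:R * (delta / 2) ^+ #|I| <=
    1 + \sum_(1 <= q < N.+1 | [forall i, int_near delta (q%:R * x i)]) 1.
Proof.
move=> d0 d1.
(* This choice gives both [K^-1 <= delta] and, as [delta <= 1], [K * delta <= 2]. The [1] in the
   bound pays for [q = 0]. *)
pose K := (Num.truncn delta^-1).+1.
have K0 : 0 < K%:R :> R by [].
have dK : K%:R^-1 <= delta by rewrite invf_ple// ltW// truncnS_gt.
have Kd : K%:R * (delta / 2) <= 1.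
  have : (Num.truncn delta^-1)%:R * delta <= 1.
    by rewrite -ler_pdivlMr// div1r truncn_le invr_ge0 ltW.
  by rewrite /K -addn1 natrD; nra.
have := @pigeonhole_near I x N K isT.
set Z := #|_| => hZ.
have ZE : Z%:R <= 1 +
    \sum_(1 <= q < N.+1 | [forall i, int_near delta (q%:R * x i)]) 1 :> R.
  rewrite /Z -sum1_card natr_sum.
  apply: (@le_trans _ _ (\sum_(q < N.+1 | [forall i, int_near delta (q%:R * x i)]) 1)).
    rewrite big_mkcond [leRHS]big_mkcond/=; apply: ler_sum => q _.
    rewrite inE; case: ifPn => [/forallP h|_]; last by case: ifP.
    by rewrite ifT//; apply/forallP => i; apply: int_near_le dK (h i).
  rewrite -(big_mkord (fun q => [forall i, int_near delta (q%:R * x i)]) (fun=> 1)).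
  by rewrite big_mkcond big_ltn// -big_mkcond lerD2r; case: ifP.
apply: le_trans ZE.
rewrite -(ler_pM2r (exprn_gt0 #|I| K0)) -mulrA -exprMn.
apply: (@le_trans _ _ N.+1%:R); last by rewrite -natrX -natrM ler_nat.
apply: (@le_trans _ _ N%:R); last by rewrite ler_nat.
rewrite ler_piMr// exprn_ile1// ?(mulrC (delta / 2))//.
by rewrite mulr_ge0 ?divr_ge0// ltW.
Qed.

(** Raising [l] by one multiplies the difference by [a] and adds [b ^+ (l + k) * (a - b)], which is
    at most [a ^+ l.+1 * (a ^+ k - b ^+ k)]: one more copy of the right-hand factor. *)
Lemma subrX_le (a b : R) l k : (0 < k)%N -> 0 <= b -> b <= a ->
  a ^+ (l + k) - b ^+ (l + k) <= l.+1%:R * (a ^+ l * (a ^+ k - b ^+ k)).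
Proof.
case: k => // k _ b0 ab; have a0 : 0 <= a := le_trans b0 ab.
elim: l => [|l IH]; first by rewrite expr0 !mul1r.
have h1 : b ^+ (l + k.+1) * (a - b) <= a ^+ l.+1 * (a ^+ k.+1 - b ^+ k.+1).
  rewrite addnS -addSn exprD -mulrA.
  apply: ler_pM; rewrite ?exprn_ge0 ?mulr_ge0 ?exprn_ge0 ?subr_ge0//.
    by rewrite lerXn2r// nnegrE.
  rewrite mulrBr -exprSr lerD2r exprSr ler_wpM2r//.
  by rewrite lerXn2r// nnegrE.
have := ler_wpM2l a0 IH; move: h1.
rewrite addSn [in X in _ -> _ -> X <= _]exprS [b ^+ (l + k.+1).+1]exprS.
rewrite -(addn1 l.+1) natrD (exprS a l).
move: (a ^+ (l + k.+1)) (b ^+ (l + k.+1)) (a ^+ l) (a ^+ k.+1 - b ^+ k.+1).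
move=> A B C E h1 h2; nra.
Qed.

(* Summation by parts: the [l] missing factors [a n] are supplied by the
   counting function of [Q]; the error [1] telescopes to [a 1 ^+ k]. *)
Lemma sum_by_parts_ge (a : nat -> R) (Q : pred nat) l k (c : R) :
  (0 < k)%N -> 0 <= c -> (forall n, (0 < n)%N -> 0 <= a n) ->
  (forall m n, (0 < m)%N -> (m <= n)%N -> a n <= a m) ->
  (forall N, (0 < N)%N ->
     c * N%:R * a N ^+ l <= 1 + \sum_(1 <= q < N.+1 | Q q) 1) ->
  forall N, c / l.+1%:R * \sum_(1 <= n < N.+1) a n ^+ (l + k) - a 1%N ^+ k <=
    \sum_(1 <= n < N.+1 | Q n) a n ^+ k.
Proof.
move=> k0 c0 a0 aM cnt; case=> [|N].
  by rewrite !big_geq// mulr0 sub0r oppr_le0 exprn_ge0// a0.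
set c' := c / _.
have l0 : 0 < l.+1%:R :> R by [].
have c'E : c' * l.+1%:R = c by rewrite divfK ?gt_eqF.
have c'0 : 0 <= c' by rewrite divr_ge0.
have c'c : c' <= c by rewrite ler_pdivrMr// ler_peMr// ler1n.
pose B N := \sum_(1 <= q < N.+1 | Q q) (1 : R).
suff inv : (1 + B N.+1) * a N.+1 ^+ k - c' * N.+1%:R * a N.+1 ^+ (l + k)
    - a 1%N ^+ k <= \sum_(1 <= n < N.+2 | Q n) a n ^+ k
      - c' * \sum_(1 <= n < N.+2) a n ^+ (l + k).
  have h := ler_wpM2r (exprn_ge0 k (a0 N.+1 isT)) (cnt N.+1 isT).
  rewrite /= -[c * _ * a N.+1 ^+ l * _]mulrA -exprD -/(B N.+1) in h.
  have h2 : 0 <= N.+1%:R * a N.+1 ^+ (l + k).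
    by rewrite mulr_ge0// exprn_ge0// a0.
  have h6 := ler_wpM2r h2 c'c; rewrite /= in h6.
  by move: inv h h6; clear; lra.
elim: N => [|N IH].
  rewrite /B big_mkcond [X in _ <= X - _]big_mkcond !big_nat1 mulr1.
  by case: ifP => _; lra.
rewrite big_nat_recr//= [X in _ <= X - _]big_mkcond big_nat_recr//= -big_mkcond.
have BS : B N.+2 = B N.+1 + (if Q N.+2 then 1 else 0).
  by rewrite /B big_mkcond big_nat_recr//= -big_mkcond.
rewrite BS.
have aa : a N.+2 <= a N.+1 by exact: aM.
have h1 := @subrX_le (a N.+1) (a N.+2) l k k0 (a0 N.+2 isT) aa.
have h2 : 0 <= a N.+1 ^+ k - a N.+2 ^+ k.
  by rewrite subr_ge0 lerXn2r// nnegrE a0.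
have h3 := ler_wpM2r h2 (cnt N.+1 isT); rewrite /= -/(B N.+1) in h3.
have N0 : 0 <= c' * N.+1%:R by rewrite mulr_ge0.
have h4 := ler_wpM2l N0 h1.
have h5 : (1 + B N.+1) * (a N.+1 ^+ k - a N.+2 ^+ k) >=
    c' * N.+1%:R * (a N.+1 ^+ (l + k) - a N.+2 ^+ (l + k)).
  apply: le_trans h4 _; apply: le_trans h3; rewrite -c'E.
  by rewrite le_eqVlt; apply/orP; left; apply/eqP; ring.
have NE : N.+2%:R = N.+1%:R + 1 :> R by rewrite natr1.
rewrite NE; move: IH h5; clear.
set A1 := a N.+1 ^+ k; set A2 := a N.+2 ^+ k.
set D1 := a N.+1 ^+ (l + k); set D2 := a N.+2 ^+ (l + k).
by case: ifP => _; lra.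
Qed.

(** Dirichlet's count at level [a N] feeds the summation by parts with [c = 2^-1 ^+ #|I|]: an
    integer [q <= N] that is good for [a N] is good for the larger [a q]. *)
Lemma divergence_near (I : finType) (x : I -> R) k (a : nat -> R) :
  (0 < k)%N -> (forall n, (0 < n)%N -> 0 < a n <= 1) ->
  (forall m n, (0 < m)%N -> (m <= n)%N -> a n <= a m) ->
  (forall C, exists N, C <= \sum_(1 <= n < N) a n ^+ (#|I| + k)) ->
  forall C, exists N,
    C <= \sum_(1 <= n < N | [forall i, int_near (a n) (n%:R * x i)]) a n ^+ k.
Proof.
move=> k0 a01 aM diva C.
set Q := fun n => [forall i, int_near (a n) (n%:R * x i)].
have a0 n : (0 < n)%N -> 0 <= a n by move=> /a01/andP[/ltW].
pose c : R := 2^-1 ^+ #|I|.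
have c0 : 0 < c by rewrite exprn_gt0// invr_gt0.
have cnt N : (0 < N)%N -> c * N%:R * a N ^+ #|I| <= 1 + \sum_(1 <= q < N.+1 | Q q) 1.
  move=> N0; have /andP[aN0 aN1] := a01 _ N0.
  rewrite (_ : _ * _ * _ = N%:R * (a N / 2) ^+ #|I|); last first.
    by rewrite exprMn /c; ring.
  apply: le_trans (count_near x N aN0 aN1) _; rewrite lerD2l.
  rewrite big_nat_cond [leRHS]big_nat_cond big_mkcond [leRHS]big_mkcond/=.
  apply: ler_sum => q _.
  case: ifPn => [/andP[/andP[q1 qN] /forallP h]|_]; last by case: ifP.
  rewrite ifT// q1 qN/=; apply/forallP => i; apply: int_near_le (h i).
  by apply: aM => //; rewrite -ltnS.
pose c' := c / #|I|.+1%:R.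
have c'0 : 0 < c' by rewrite divr_gt0.
have [N] := diva ((C + a 1%N ^+ k) / c').
rewrite ler_pdivrMr// => hN; exists N.
case: N hN => [|N]; last first.
  move=> hN; apply: le_trans (sum_by_parts_ge k0 (ltW c0) a0 aM cnt N).
  by rewrite -/c'; lra.
rewrite !big_geq// mul0r => h; apply: le_trans h.
by rewrite lerDl exprn_ge0 ?a0.
Qed.

End counting.

Local Open Scope classical_set_scope.

(** * Lower bounds for measures of finite unions *)

Section finite_unions.
Context d (T : measurableType d) (R : realType) (mu : {measure set T -> \bar R}).
Context (I : choiceType).
Implicit Types (r : seq I) (E : I -> set T).

Lemma le_measure_bigsetU E r : (forall i, measurable (E i)) ->
  (mu (\big[setU/set0]_(i <- r) E i) <= \sum_(i <- r) mu (E i))%E.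
Proof.
move=> mE; elim: r => [|i r IH]; first by rewrite !big_nil measure0.
rewrite !big_cons; apply: le_trans (measureU2 _ _ _) _ => //.
  exact: bigsetU_measurable.
by rewrite leeD2l.
Qed.

(** Adding [E n] to the union over [r] loses at most the overlaps [C * (w n * W)], where [W] is the
    sum of the weights in [r], while [C * W ^+ 2] grows by at least twice that. *)
Lemma bonferroni E r (e w : I -> R) (C : R) :
  (forall i, measurable (E i)) -> uniq r -> 0 <= C ->
  {in r, forall i, 0 <= w i} -> {in r, forall i, ((e i)%:E <= mu (E i))%E} ->
  {in r &, forall i j, i != j ->
     (mu (E i `&` E j) <= (C * (w i * w j))%:E)%E} ->
  ((\sum_(i <- r) e i - C * (\sum_(i <- r) w i) ^+ 2)%:E <=
    mu (\big[setU/set0]_(i <- r) E i))%E.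
Proof.
move=> mE + C0; elim: r => [|n r IH]; first by rewrite !big_nil expr0n mulr0 subrr.
move=> /= /andP[nr ur] w0 eE EE; rewrite !big_cons.
have {}IH := IH ur (fun i ir => w0 i (mem_behead (s := n :: r) ir))
  (fun i ir => eE i (mem_behead (s := n :: r) ir))
  (fun i j ir jr => EE i j (mem_behead (s := n :: r) ir)
                          (mem_behead (s := n :: r) jr)).
set U := \big[setU/set0]_(i <- r) E i in IH *.
have mU : measurable U by exact: bigsetU_measurable.
have nU : (mu (E n `&` U) <= (C * (w n * \sum_(i <- r) w i))%:E)%E.
  rewrite /U big_distrr/=; apply: le_trans (le_measure_bigsetU _ _) _.
    by move=> i; exact: measurableI.
  rewrite !mulr_sumr -sumEFin big_seq [leRHS]big_seq; apply: lee_sum => i ir.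
  rewrite EE ?inE ?eqxx ?ir ?orbT//.
  by apply: contraNneq nr => ->.
have UE : (mu (E n `|` U) = mu U + mu (E n `\` U))%E.
  rewrite (_ : E n `|` U = U `|` (E n `\` U)); last first.
    by apply/seteqP; split => x /=; have [] := pselect (U x); tauto.
  rewrite measureU//; first exact: measurableD.
  by rewrite setDIK.
have nE := eE n (mem_head _ _).
rewrite (measureDI mu (mE n) mU) in nE.
have {}nE : ((e n - C * (w n * \sum_(i <- r) w i))%:E <= mu (E n `\` U))%E.
  rewrite EFinB leeBlDr//; apply: le_trans nE _.
  by rewrite leeD2l.
rewrite UE; apply: le_trans (leeD IH nE).
rewrite -EFinD lee_fin; set W := \sum_(i <- r) w i.
have W0 : 0 <= W.
  by rewrite /W big_seq sumr_ge0// => i ir; rewrite w0// inE ir orbT.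
have := w0 n (mem_head _ _) => wn.
have h : 0 <= C * (w n * w n + w n * W) by rewrite mulr_ge0 ?addr_ge0 ?mulr_ge0.
by rewrite -subr_ge0; apply: le_trans h _; rewrite le_eqVlt; apply/orP; left;
  apply/eqP; ring.
Qed.

Lemma sum_measure_le_bigsetU E r (e : I -> R) :
  (forall i, measurable (E i)) -> uniq r ->
  {in r, forall i, ((e i)%:E <= mu (E i))%E} ->
  {in r &, forall i j, i != j -> E i `&` E j = set0} ->
  ((\sum_(i <- r) e i)%:E <= mu (\big[setU/set0]_(i <- r) E i))%E.
Proof.
move=> mE ur eE EE.
have := @bonferroni E r e (fun=> 0) 0 mE ur (lexx 0) (fun _ _ => lexx 0) eE.
move=> H; apply: le_trans (H _); first by rewrite lee_fin mul0r subr0.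
by move=> i j ir jr ij; rewrite EE// measure0 mul0r.
Qed.

End finite_unions.

(** * Cubes cornered at primitive rational points: measure and overlaps *)

Section cubes.
Context {R : realType} {k : nat}.

Definition cube (c : 'I_k -> R) (w : R) : set (k.-tuple R) :=
  [set t | forall i, c i <= tnth t i < c i + w].

Lemma cubeE c w : cube c w = [set t | forall i, `[c i, c i + w[%classic (tnth t i)].
Proof. by apply/seteqP; split => t h i; have := h i; rewrite /= in_itv. Qed.

Lemma measurable_cube c w : measurable (cube c w).
Proof.
rewrite cubeE (_ : mkset _ = \bigcap_(i in [set: 'I_k])
    ((@tnth k R ^~ i) @^-1` `[c i, c i + w[%classic)); last first.
  by apply/seteqP; split => [t /= h i _|t h i]; exact: h.
apply: (@fin_bigcap_measurable _ (k.-tuple R : measurableType _)) => // i _.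
by rewrite -[X in measurable X]setTI; exact: measurable_tnth.
Qed.

Lemma lebesgue_cube c w : 0 <= w -> lebesgue_tuple k (cube c w) = (w ^+ k)%:E.
Proof.
move=> w0; rewrite cubeE.
rewrite (@lebesgue_tuple_box R k (fun i => `[c i, c i + w[%classic)); last first.
  by move=> i; exact: measurable_itv.
rewrite (eq_bigr (fun=> w%:E)); last first.
  move=> i _; rewrite lebesgue_measure_itv/= lte_fin ltrDl.
  case: ltP => [_|w0']; first by rewrite -EFinB addrC addKr.
  by congr (_%:E); apply/eqP; rewrite eq_le w0 w0'.
by rewrite prodEFin prodr_const card_ord.
Qed.

Lemma cubeI_close c w c' w' t : cube c w t -> cube c' w' t ->
  forall i, `|c i - c' i| < Num.max w w'.
Proof.
move=> h h' i; have /andP[a b] := h i; have /andP[a' b'] := h' i.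
by rewrite lt_max !ltr_norml; case: (leP (c i) (c' i)) => cc; apply/orP;
  [left|right]; apply/andP; split; lra.
Qed.

Lemma lebesgue_cubeI_le c w c' w' : 0 <= w -> 0 <= w' ->
  (lebesgue_tuple k (cube c w `&` cube c' w') <= (Num.min w w' ^+ k)%:E)%E.
Proof.
move=> w0 w'0; rewrite minEle; case: ifP => _.
  rewrite -(lebesgue_cube c w0); apply: measureIl; exact: measurable_cube.
rewrite -(lebesgue_cube c' w'0); apply: measureIr; exact: measurable_cube.
Qed.

(* Inside the cube with corner [c * v] and side [v], the union of the cubes of
   relative side [a / n] cornered at the points with primitive numerator [s]
   and denominator [n]. *)
Definition primitive_cubes (c : 'I_k -> R) (v a : R) (n : nat) :
    set (k.-tuple R) :=
  \big[setU/set0]_(s <- enum [set s : {ffun 'I_k -> 'I_n} | prim s]%SET)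
    cube (fun i => (c i + (s i)%:R / n%:R) * v) (a / n%:R * v).

Lemma primitive_cubesP c v a n t : primitive_cubes c v a n t ->
  exists2 s : {ffun 'I_k -> 'I_n}, prim s &
    cube (fun i => (c i + (s i)%:R / n%:R) * v) (a / n%:R * v) t.
Proof.
rewrite /primitive_cubes -bigcup_seq => -[s /=].
by rewrite mem_enum inE => sp ts; exists s.
Qed.

Lemma measurable_primitive_cubes c v a n : measurable (primitive_cubes c v a n).
Proof. by apply: bigsetU_measurable => s _; exact: measurable_cube. Qed.

(** By [card_prim] there are at least [n ^ k / 4] cubes of side [a / n * v]; their corners lie on a
    grid of mesh [v / n], so [a <= 1] makes them disjoint. *)
Lemma lebesgue_primitive_cubes_ge c (v a : R) n : (2 <= k)%N -> (0 < n)%N ->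
  0 < v -> 0 <= a <= 1 ->
  ((a ^+ k / 4 * v ^+ k)%:E <= lebesgue_tuple k (primitive_cubes c v a n))%E.
Proof.
move=> k2 n0 v0 /andP[a0 a1]; have n0R : 0 < n%:R :> R by rewrite ltr0n.
set S := [set s : {ffun 'I_k -> 'I_n} | prim s]%SET.
apply: (@le_trans _ _ (\sum_(s <- enum S) (a / n%:R * v) ^+ k)%:E).
  rewrite lee_fin big_enum/= sumr_const.
  have := @card_prim R k n k2 n0; rewrite -/S => h.
  rewrite -[leRHS]mulr_natl !exprMn exprVn.
  have nk : 0 < n%:R ^+ k :> R by rewrite exprn_gt0.
  rewrite [leRHS](_ : _ = #|S|%:R * a ^+ k / n%:R ^+ k * v ^+ k); last by ring.
  rewrite ler_wpM2r ?exprn_ge0 ?(ltW v0)// ler_pdivlMr//.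
  have := ler_wpM2l (exprn_ge0 k a0) h; lra.
apply: sum_measure_le_bigsetU.
- by move=> s; exact: measurable_cube.
- exact: enum_uniq.
- by move=> s _; rewrite lebesgue_cube// mulr_ge0 ?divr_ge0// ltW.
move=> s t _ _ st; apply/seteqP; split => // y [/= ys yt].
have close := cubeI_close ys yt.
case/eqP : st; apply/ffunP => i; apply: val_inj; apply/eqP => /=.
have := close i; rewrite maxxx -mulrBl normrM (gtr0_norm v0) ltr_pM2r//.
rewrite opprD addrACA subrr add0r -mulrBl normrM normfV (gtr0_norm n0R).
rewrite ltr_pM2r ?invr_gt0// => h.
have {}h : `|(s i)%:R - (t i)%:R| < 1 :> R by exact: lt_le_trans a1.
move: h; case: (ltngtP (s i) (t i)) => // st; apply: contraTT => _.
  by rewrite -leNgt distrC -natrB ?(ltnW st)// ger0_norm// ler1n subn_gt0.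
by rewrite -leNgt -natrB ?(ltnW st)// ger0_norm// ler1n subn_gt0.
Qed.

(** Two cubes meet only if [|s i * m - t i * n| < D] for every [i], which leaves at most
    [(3 * D) ^ k] pairs. An overlap is at most the [k]-th power of the smaller side; the larger side
    is [D / (n * m) * v], so [D] times the smaller one is [a * b * v]. *)
Lemma lebesgue_primitive_cubesI_le c (v a b : R) n m : (0 < n)%N -> (0 < m)%N ->
  n != m -> 0 < v -> 0 <= a -> 0 <= b ->
  (lebesgue_tuple k (primitive_cubes c v a n `&` primitive_cubes c v b m) <=
    (3 ^+ k * (a ^+ k * b ^+ k) * v ^+ k)%:E)%E.
Proof.
move=> n0 m0 nm v0 a0 b0.
have n0R : 0 < n%:R :> R by rewrite ltr0n.
have m0R : 0 < m%:R :> R by rewrite ltr0n.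
pose D := Num.max (a * m%:R) (b * n%:R).
pose P := [set p : 'I_n * 'I_m | `|p.1%:R * m%:R - p.2%:R * n%:R| < D]%SET.
pose Z := [set st : {ffun 'I_k -> 'I_n} * {ffun 'I_k -> 'I_m} |
  [&& prim st.1, prim st.2 & [forall i, (st.1 i, st.2 i) \in P]]]%SET.
have rhs0 : 0 <= 3 ^+ k * (a ^+ k * b ^+ k) * v ^+ k.
  by rewrite !mulr_ge0 ?exprn_ge0// ltW.
pose E (st : {ffun 'I_k -> 'I_n} * {ffun 'I_k -> 'I_m}) :=
  cube (fun i => (c i + (st.1 i)%:R / n%:R) * v) (a / n%:R * v) `&`
  cube (fun i => (c i + (st.2 i)%:R / m%:R) * v) (b / m%:R * v).
have wE : Num.max (a / n%:R * v) (b / m%:R * v) = D / (n%:R * m%:R) * v.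
  rewrite /D -(maxr_pMl _ _ (ltW v0)); congr (_ * _).
  rewrite maxr_pMl ?invr_ge0 ?mulr_ge0// ; congr Num.max; field;
    by rewrite !gt_eqF.
have sub : primitive_cubes c v a n `&` primitive_cubes c v b m `<=`
    \big[setU/set0]_(st <- enum Z) E st.
  move=> y [/primitive_cubesP[s sp ys] /primitive_cubesP[t tp yt]].
  rewrite -bigcup_seq; exists (s, t) => //=; rewrite mem_enum inE/= sp tp/=.
  apply/forallP => i; rewrite inE/=.
  have := cubeI_close ys yt i; rewrite wE -mulrBl normrM (gtr0_norm v0) ltr_pM2r//.
  rewrite ltr_pdivlMr ?mulr_gt0// -[X in _ * X]gtr0_norm ?mulr_gt0// -normrM.
  congr (`|_| < _); field; by rewrite !gt_eqF.
apply: le_trans (le_measure _ _ _ sub) _.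
- by rewrite inE; apply: measurableI; exact: measurable_primitive_cubes.
- rewrite inE; apply: bigsetU_measurable => st _.
  by apply: measurableI; exact: measurable_cube.
apply: le_trans (le_measure_bigsetU _ _ _) _.
  by move=> st; apply: measurableI; exact: measurable_cube.
(* If [Z] is empty, so is the overlap. Otherwise one pair in [Z] has distinct fractions, so some
   [s i * m - t i * n] is a nonzero multiple of the gcd, and the gcd is below [D]. *)
case: (set_0Vmem Z) => [->|[[s t]]].
  by rewrite finset.enum_set0 big_nil lee_fin.
rewrite inE/= => /and3P[sp tp /forallP stP].
have gD : (gcdn n m)%:R < D.
  have [i neq] := prim_neq n0 m0 sp tp nm.
  have := stP i; rewrite inE/=; apply: le_lt_trans.
  have g1 : (gcdn n m %| s i * m)%N by rewrite dvdn_mull// dvdn_gcdr.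
  have g2 : (gcdn n m %| t i * n)%N by rewrite dvdn_mull// dvdn_gcdl.
  rewrite -!natrM; case: (ltngtP (s i * m)%N (t i * n)%N) neq => // lt _.
    rewrite distrC -natrB ?(ltnW lt)// ger0_norm// ler_nat.
    by rewrite dvdn_leq ?subn_gt0// dvdn_sub.
  rewrite -natrB ?(ltnW lt)// ger0_norm// ler_nat.
  by rewrite dvdn_leq ?subn_gt0// dvdn_sub.
have cP := card_close_pairs n0 m0 gD; rewrite -/P in cP.
have cZ : (#|Z| <= #|P| ^ k)%N.
  pose f (st : {ffun 'I_k -> 'I_n} * {ffun 'I_k -> 'I_m}) :=
    [ffun i => (st.1 i, st.2 i)].
  have fi : injective f.
    move=> [s1 t1] [s2 t2] /ffunP fE; congr (_, _); apply/ffunP => i.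
      by have := fE i; rewrite !ffunE/= => -[].
    by have := fE i; rewrite !ffunE/= => -[].
  rewrite -(card_imset _ fi) -[X in (_ ^ X)%N]card_ord -card_ffun_on.
  apply: subset_leq_card; apply/fintype.subsetP => _ /imsetP[st + ->].
  rewrite inE => /and3P[_ _ /forallP h]; apply/ffun_onP => i.
  by rewrite ffunE; exact: h.
pose w := Num.min (a / n%:R * v) (b / m%:R * v).
have w0 : 0 <= w by rewrite le_min !mulr_ge0 ?invr_ge0// ltW.
apply: (@le_trans _ _ (\sum_(st <- enum Z) (w ^+ k)%:E)%E).
  apply: lee_sum => st _; apply: lebesgue_cubeI_le.
    by rewrite !mulr_ge0 ?invr_ge0// ltW.
  by rewrite !mulr_ge0 ?invr_ge0// ltW.
rewrite sumEFin big_enum/= sumr_const lee_fin -[leLHS]mulr_natl.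
have Dw : D * w = a * b * v.
  have : Num.max (a / n%:R * v) (b / m%:R * v) * w = (a / n%:R * v) * (b / m%:R * v).
    by rewrite /w maxEle minEle; case: ifP => // _; rewrite mulrC.
  rewrite wE => h.
  have -> : D * w = (D / (n%:R * m%:R) * v * w) * (n%:R * m%:R) / v.
    by field; rewrite !gt_eqF.
  by rewrite h; field; rewrite !gt_eqF.
rewrite -!exprMn [X in _ <= X ^+ k](_ : _ = 3 * D * w); last first.
  by rewrite -[RHS]mulrA Dw; ring.
rewrite exprMn ler_wpM2r ?exprn_ge0//.
apply: (@le_trans _ _ (#|P|%:R ^+ k)); first by rewrite -natrX ler_nat.
by rewrite lerXn2r ?nnegrE//; exact: le_trans cP.
Qed.

End cubes.

(** * Covering a fixed proportion of a cube *)

Section local_hitting.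
Context {R : realType}.

(* As long as [\sum a n ^+ k <= 2 * hit k], the overlaps
   [3 ^+ k * (\sum a n ^+ k) ^+ 2] are at most half of the measures
   [\sum a n ^+ k / 4]. *)
Definition hit (k : nat) : R := (16 * 3 ^+ k)^-1.

Lemma hit_gt0 k : 0 < hit k.
Proof. by rewrite invr_gt0 mulr_gt0// exprn_gt0. Qed.

Lemma hit_le1 k : hit k <= 1.
Proof.
rewrite invf_le1 ?mulr_gt0 ?exprn_gt0//.
have : 1 <= 3 ^+ k :> R by rewrite exprn_ege1// ler1n.
lra.
Qed.

(** At the first [N] where the sum reaches [tau], the overshoot is at most one term, itself at most
    [tau]. *)
Lemma sum_window (w : nat -> R) (Q : pred nat) (tau : R) m : 0 < tau ->
  (forall n, (0 < n)%N -> 0 <= w n <= tau) ->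
  (forall C, exists N, C <= \sum_(1 <= n < N | Q n) w n) -> (0 < m)%N ->
  exists N, tau <= \sum_(m <= n < N | Q n) w n <= 2 * tau.
Proof.
move=> tau0 w01 div m0.
have ge0 a b : (0 < a)%N -> 0 <= \sum_(a <= n < b | Q n) w n.
  move=> a0; rewrite big_nat_cond sumr_ge0// => n /andP[/andP[an _] _].
  by have /andP[] := w01 n (leq_trans a0 an).
have ex : exists N, tau <= \sum_(m <= n < N | Q n) w n.
  have [N hN] := div (tau + \sum_(1 <= n < m | Q n) w n).
  exists N; have [mN|Nm] := leqP m N.
    by move: hN; rewrite (@big_cat_nat _ _ _ m 1 N)//=; lra.
  have [N0|N0] := posnP N.
    move: hN; rewrite N0 [X in _ <= X -> _]big_geq//.
    by have := ge0 1%N m isT; lra.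
  move: hN; rewrite (@big_cat_nat _ _ _ N 1 m)//= ?(ltnW Nm)//.
  by have := ge0 N m N0; lra.
case: (ex_minnP ex) => N hN Nmin; exists N; rewrite hN/=.
have mN : (m < N)%N.
  by rewrite ltnNge; apply: contraL hN => Nm; rewrite big_geq// -ltNge.
case: N mN hN Nmin => // N; rewrite ltnS => mN hN Nmin.
have lt : \sum_(m <= n < N | Q n) w n < tau.
  by rewrite ltNge; apply/negP => /Nmin; rewrite ltnn.
rewrite big_mkcond big_nat_recr//= -big_mkcond.
have /andP[w0 w1] := w01 N (leq_trans m0 mN).
by case: ifP => _; lra.
Qed.

Lemma lebesgue_primitive_union_ge k (c : 'I_k -> R) (v : R) (a : nat -> R)
    (Q : pred nat) m : (2 <= k)%N -> 0 < v -> (0 < m)%N ->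
  (forall n, (0 < n)%N -> 0 <= a n <= hit k) ->
  (forall C, exists N, C <= \sum_(1 <= n < N | Q n) a n ^+ k) ->
  exists N, ((hit k / 8 * v ^+ k)%:E <= lebesgue_tuple k
    (\big[setU/set0]_(n <- [seq n <- index_iota m N | Q n])
       primitive_cubes c v (a n) n))%E.
Proof.
move=> k2 v0 m0 a01 div.
have wh n : (0 < n)%N -> 0 <= a n ^+ k <= hit k.
  move=> /a01/andP[an0 anh]; have an1 := le_trans anh (hit_le1 k).
  rewrite exprn_ge0//=; apply: le_trans anh.
  by rewrite -(prednK (ltnW k2)) exprS ler_piMr// exprn_ile1.
have [N /andP[S1 S2]] := sum_window (hit_gt0 k) wh div m0; exists N.
set r := [seq n <- _ | _].
have rm n : n \in r -> (0 < n)%N.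
  by rewrite mem_filter mem_index_iota => /andP[_ /andP[mn _]]; exact: leq_trans mn.
apply: le_trans (@bonferroni _ _ _ (lebesgue_tuple k) _
  (fun n => primitive_cubes c v (a n) n) r
  (fun n => a n ^+ k / 4 * v ^+ k) (fun n => a n ^+ k) (3 ^+ k * v ^+ k) _ _ _ _ _ _).
- rewrite lee_fin -!mulr_suml big_filter; set S := \sum_(_ <= _ < _ | _) _ in S1 S2 *.
  have hE : 3 ^+ k * hit k = 1 / 16.
    by rewrite /hit; field; rewrite expf_neq0.
  (* From [S <= 2 * hit k] the factor [3 ^+ k * S] is at most [1 / 8], so at least
     [S / 8 >= hit k / 8] survives. *)
  rewrite [leRHS](_ : _ = (S * (1 / 4 - 3 ^+ k * S)) * v ^+ k); last by ring.
  rewrite ler_wpM2r ?exprn_ge0 ?(ltW v0)//.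
  have h3 : 3 ^+ k * S <= 1 / 8.
    have := ler_wpM2l (exprn_ge0 k (ler0n R 3)) S2; lra.
  have h0 := hit_gt0 k; nra.
- by move=> n; exact: measurable_primitive_cubes.
- by rewrite filter_uniq// iota_uniq.
- by rewrite mulr_ge0 ?exprn_ge0// ltW.
- by move=> n /rm/wh/andP[].
- move=> n /rm n0; apply: lebesgue_primitive_cubes_ge => //.
  have /andP[-> /=] := a01 n n0; move/le_trans; apply; exact: hit_le1.
move=> n n' /rm n0 /rm n'0 nn'.
rewrite [leRHS](_ : _ = (3 ^+ k * (a n ^+ k * a n' ^+ k) * v ^+ k)%:E); last first.
  by congr (_%:E); ring.
apply: lebesgue_primitive_cubesI_le => //.
  by have /andP[] := a01 n n0.
by have /andP[] := a01 n' n'0.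
Qed.

End local_hitting.

(** * Closed sets missing a fixed proportion of every dyadic cube *)

Section null_sets.
Context {R : realType} {k : nat}.
Context (F : set (k.-tuple R)) (theta : R).
Context (theta01 : 0 < theta <= 1) (mF : measurable F).
Context (closedF : forall y, ~ F y -> exists2 e : R, 0 < e &
  forall z, (forall i, `|tnth z i - tnth y i| < e) -> ~ F z).
Context (dyadicF : forall (j : nat) (c : 'I_k -> int),
  (lebesgue_tuple k (F `&` cube (fun i => (c i)%:~R * 2 ^- j)%R (2 ^- j)%R) <=
    ((1 - theta) * (2 ^- j) ^+ k)%:E)%E).

Let mu := lebesgue_tuple k : {measure set (k.-tuple R) -> \bar R}.

(** The dyadic cubes of side [2 ^- j] meeting [K] form sets [G j] decreasing to [K], with
    [mu K <= (1 - theta) * mu (G j)]. In the limit [mu K <= (1 - theta) * mu K], and [mu K] is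
    finite. *)
Lemma null_unit_cube (c0 : 'I_k -> int) :
  mu (F `&` cube (fun i => (c0 i)%:~R) 1) = 0%E.
Proof.
have /andP[th0 th1] := theta01.
set K := F `&` _.
pose v j : R := 2 ^- j.
have v0 j : 0 < v j by rewrite invr_gt0 exprn_gt0.
have vE j : (2 ^ j)%:R * v j = 1 by rewrite natrX mulfV// expf_neq0.
have vS j : v j = 2 * v j.+1.
  by rewrite /v exprS invfM mulrA mulfV// mul1r.
pose sub j (b : {ffun 'I_k -> 'I_(2 ^ j)}) : set (k.-tuple R) :=
  cube (fun i => (c0 i * (2 ^ j)%:Z + (b i)%:Z)%:~R * v j) (v j).
have subE j b t : sub j b t -> forall i,
    (c0 i)%:~R + (b i)%:R * v j <= tnth t i < (c0 i)%:~R + (b i)%:R * v j + v j.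
  move=> h i; have := h i; rewrite intrD intrM mulrDl -!pmulrn.
  by rewrite -mulrA vE mulr1.
have Esub j (b : {ffun 'I_k -> 'I_(2 ^ j)}) (t : k.-tuple R) : (forall i,
    (c0 i)%:~R + (b i)%:R * v j <= tnth t i < (c0 i)%:~R + (b i)%:R * v j + v j) ->
    sub j b t.
  move=> h i; have := h i; rewrite intrD intrM mulrDl -!pmulrn.
  by rewrite -[(c0 i)%:~R * _ * _]mulrA vE mulr1.
pose T j := [set b | `[< exists z, K z /\ sub j b z >]]%SET.
pose G j := \big[setU/set0]_(b <- enum (T j)) sub j b.
have GP j t : G j t <-> exists b, (exists z, K z /\ sub j b z) /\ sub j b t.
  rewrite /G -bigcup_seq; split => [[b /=]|[b [bz bt]]].
    by rewrite mem_enum inE => /asboolP bz bt; exists b.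
  by exists b => //=; rewrite mem_enum inE; exact/asboolP.
have msub j b : measurable (sub j b) by exact: measurable_cube.
have mG j : measurable (G j) by exact: bigsetU_measurable.
have mK : measurable K by apply: measurableI => //; exact: measurable_cube.
have KG j t : K t -> exists b, sub j b t.
  move=> [_ tc]; have P i : exists b : 'I_(2 ^ j),
      (c0 i)%:~R + b%:R * v j <= tnth t i < (c0 i)%:~R + b%:R * v j + v j.
    have /andP[t0 t1] := tc i.
    set z := (2 ^ j)%:R * (tnth t i - (c0 i)%:~R).
    have z0 : 0 <= z by rewrite mulr_ge0// subr_ge0.
    have zlt : (Num.truncn z < 2 ^ j)%N.
      rewrite truncn_lt_nat// /z gtr_pMr ?ltr0n ?expn_gt0//; lra.
    have zv : tnth t i = (c0 i)%:~R + z * v j.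
      by rewrite /z mulrAC vE mul1r addrC subrK.
    exists (Ordinal zlt); have /andP[z1 z2] := truncn_itv z0.
    rewrite zv -addrA lerD2l ltrD2l ler_wpM2r ?(ltW (v0 j))//=.
    rewrite -[X in _ < _ + X]mul1r -mulrDl ltr_pM2r// natr1.
    exact: z2.
  have [f fP] := choice P.
  by exists [ffun i => f i]; apply: Esub => i; rewrite ffunE.
have mu_sub j b : mu (sub j b) = (v j ^+ k)%:E.
  by rewrite /mu lebesgue_cube// ltW.
have G_ge j : ((\sum_(b <- enum (T j)) v j ^+ k)%:E <= mu (G j))%E.
  apply: sum_measure_le_bigsetU => //.
  - exact: enum_uniq.
  - by move=> b _; rewrite mu_sub.
  move=> b b' _ _ bb'; apply/seteqP; split => // y [yb yb'].
  case/eqP : bb'; apply/ffunP => i; apply: val_inj => /=.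
  have /andP[h1 h2] := subE _ _ _ yb i; have /andP[h3 h4] := subE _ _ _ yb' i.
  have h5 : (b i)%:R * v j < ((b' i)%:R + 1) * v j by lra.
  have h6 : (b' i)%:R * v j < ((b i)%:R + 1) * v j by lra.
  move: h5 h6; rewrite !ltr_pM2r// !natr1 !ltr_nat !ltnS => h5 h6.
  by apply/eqP; rewrite eqn_leq h5 h6.
have G_le j : (mu (G j) <= (\sum_(b <- enum (T j)) v j ^+ k)%:E)%E.
  apply: le_trans (le_measure_bigsetU _ _ _) _ => //.
  by rewrite -sumEFin; apply: lee_sum => b _; rewrite mu_sub.
have K_le j : (mu K <= (1 - theta)%:E * mu (G j))%E.
  apply: (@le_trans _ _ (mu (\big[setU/set0]_(b <- enum (T j)) (K `&` sub j b)))).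
    apply: le_measure; rewrite ?inE//.
      by apply: bigsetU_measurable => b _; exact: measurableI.
    move=> y Ky; have [b yb] := KG j y Ky; rewrite -bigcup_seq; exists b => //=.
    by rewrite mem_enum inE; apply/asboolP; exists y.
  apply: le_trans (le_measure_bigsetU _ _ _) _.
    by move=> b; exact: measurableI.
  apply: (@le_trans _ _ (\sum_(b <- enum (T j)) ((1 - theta) * v j ^+ k)%:E)%E).
    apply: lee_sum => b _; apply: le_trans (dyadicF _ _).
    apply: le_measure; rewrite ?inE//; first exact: measurableI.
      by apply: measurableI => //; exact: measurable_cube.
    by move=> y [[Fy _] yb]; split => //; exact: yb.
  rewrite sumEFin -mulr_sumr EFinM lee_wpmul2l// lee_fin; lra.
have capG : \bigcap_j G j = K.
  apply/seteqP; split => [y yG|y Ky j _]; last first.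
    by have [b yb] := KG j y Ky; apply/GP; exists b; split => //; exists y.
  (* The cube is half-open, so [K] may fail to be closed: level [0] puts [y] in the cube, and
     [closedF] then puts it in [F]. *)
  have Kc : cube (fun i => (c0 i)%:~R) 1 y.
    have /GP[b [_ yb]] := yG 0%N I; move=> i; have := subE _ _ _ yb i.
    have -> : nat_of_ord (b i) = 0%N.
      by apply/eqP; rewrite -leqn0 -ltnS (leq_trans (ltn_ord _)).
    by rewrite /v expr0 invr1 mul0r addr0.
  split => //; apply: contrapT => /closedF[e e0 he].
  have [j ej] : exists j, v j < e.
    exists (Num.bound e^-1); rewrite /v invf_plt ?posrE ?exprn_gt0//.
    exact: upper_nthrootP.
  have /GP[b [[z [Kz zb]] yb]] := yG j I.
  apply: (he z _ Kz.1) => i; apply: lt_trans ej.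
  have /andP[h1 h2] := subE _ _ _ yb i; have /andP[h3 h4] := subE _ _ _ zb i.
  by rewrite ltr_norml; apply/andP; split; lra.
(* Halving the index [b] yields the parent cube, which still meets [K]. *)
have nestG : {homo G : n m / (n <= m)%N >-> (m <= n)%O}.
  apply/nonincreasing_seqP => j; apply/subsetPset => y /GP[b [[z [Kz zb]] yb]].
  have lt i : ((b i)./2 < 2 ^ j)%N.
    by rewrite ltn_half_double -mul2n -expnS.
  pose b' : {ffun 'I_k -> 'I_(2 ^ j)} := [ffun i => Ordinal (lt i)].
  have bb t : sub j.+1 b t -> sub j b' t.
    move=> h; apply: Esub => i; have := subE _ _ _ h i; rewrite ffunE/= (vS j).
    set w := v j.+1; have w0 : 0 < w := v0 _.
    have e : (b i)%:R = (odd (b i))%:R + 2 * ((b i)./2)%:R :> R.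
      by rewrite -natrM -natrD mul2n odd_double_half.
    have o0 : 0 <= (odd (b i))%:R * w by rewrite mulr_ge0// ltW.
    have o1 : (odd (b i))%:R * w <= w by rewrite ler_piMl ?lern1 ?leq_b1// ltW.
    by rewrite e => /andP[h1 h2]; apply/andP; split; lra.
  by apply/GP; exists b'; split; [exists z; split => //|]; exact: bb.
have cvgG : mu (G j) @[j --> \oo] --> mu K.
  rewrite -capG; apply: nonincreasing_cvg_mu => //.
    by apply: le_lt_trans (G_le 0%N) _; rewrite ltry.
  by rewrite capG.
have Kfin : (mu K < +oo)%E.
  rewrite -capG; apply: le_lt_trans (le_lt_trans (G_le 0%N) (ltry _)).
  apply: le_measure; rewrite ?inE ?capG//.
  by rewrite -capG => y; apply.
have KK : (mu K <= (1 - theta)%:E * mu K)%E.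
  apply: (cvge_ge _ (cvgeZl (y := (1 - theta)%:E) _ cvgG)) => //.
  by near=> j; exact: K_le.
have K0 : (0 <= mu K)%E by exact: measure_ge0.
move: KK K0 Kfin; case: (mu K) => [x| |]//.
rewrite -EFinM !lee_fin => h1 h2 _; congr (_%:E).
by apply/eqP; rewrite eq_le h2 andbT -(pmulr_rle0 x th0); lra.
Unshelve. all: by end_near. Qed.

Lemma null_of_dyadic : mu F = 0%E.
Proof.
apply/negligibleP => //.
(* Countably many integer unit cubes cover the space; [unpickle] enumerates their corners. *)
pose u (n : nat) : set (k.-tuple R) :=
  if unpickle n is Some c then F `&` cube (fun i => ((c : {ffun 'I_k -> int}) i)%:~R) 1
  else set0.
apply: (@negligibleS _ _ _ _ (\bigcup_n u n)).
  move=> y Fy.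
  exists (pickle [ffun i => Num.floor (tnth y i)]) => //.
  rewrite /u pickleK; split => // i; rewrite ffunE floor_le/=.
  by have := floorD1_gt (tnth y i); rewrite intrD.
apply: negligible_bigcup => n; rewrite /u; case: unpickle => [c|].
  apply/negligibleP; last exact: null_unit_cube.
  by apply: measurableI => //; exact: measurable_cube.
exact: negligible_set0.
Qed.

End null_sets.

(** * Divergence under dilation and truncation *)

Section divergence.
Context {R : realType}.
Implicit Types (u psi : nat -> R).

Lemma unbounded_of_Ncvgn u : (forall n, (0 < n)%N -> 0 <= u n) ->
  ~ cvgn (fun n => \sum_(1 <= q < n) u q) ->
  forall C, exists N, C <= \sum_(1 <= q < N) u q.
Proof.
move=> u0 ncv C; apply: contrapT => /forallNP h; apply: ncv.
apply: nondecreasing_is_cvgn.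
  move=> m n mn; have [->|m0] := posnP m.
    by rewrite big_geq// big_nat_cond sumr_ge0// => q /andP[/andP[q1 _] _]; exact: u0.
  rewrite [leRHS](@big_cat_nat _ _ _ m 1 n)//= lerDl big_nat_cond sumr_ge0//.
  by move=> q /andP[/andP[mq _] _]; apply: u0; exact: leq_trans mq.
exists C => _ [n _ <-]; rewrite leNgt; apply/negP => /ltW; exact: h.
Qed.

(** By monotonicity the block of [M] terms starting at [M * n] contributes at most [M * u (M * n)];
    the terms below [M] add a constant. *)
Lemma unbounded_dilate u M : (0 < M)%N -> (forall n, (0 < n)%N -> 0 <= u n) ->
  (forall p q, (0 < p)%N -> (p <= q)%N -> u q <= u p) ->
  (forall C, exists N, C <= \sum_(1 <= q < N) u q) ->
  forall C, exists N, C <= \sum_(1 <= n < N) u (M * n)%N.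
Proof.
move=> M0 u0 uM div C.
have MR : 0 < M%:R :> R by rewrite ltr0n.
have le N : \sum_(1 <= q < M * N.+1) u q <=
    \sum_(1 <= q < M) u q + M%:R * \sum_(1 <= n < N.+1) u (M * n)%N.
  elim: N => [|N IH]; first by rewrite muln1 [X in _ * X]big_geq// mulr0 addr0.
  rewrite (@big_cat_nat _ _ _ (M * N.+1) 1 (M * N.+2))/= ?muln_gt0 ?M0// ?leq_mul//.
  rewrite [X in _ <= _ + _ * X]big_nat_recr//= mulrDr addrA lerD//.
  apply: (@le_trans _ _ (\sum_(M * N.+1 <= q < M * N.+2) u (M * N.+1)%N)).
    rewrite big_nat_cond [leRHS]big_nat_cond; apply: ler_sum.
    by move=> q /andP[/andP[h1 h2] _]; apply: uM => //; rewrite muln_gt0 M0.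
  by rewrite sumr_const_nat -mulnBr subSnn muln1 mulr_natl.
have [N hN] := div (\sum_(1 <= q < M) u q + M%:R * C).
exists N.+1; rewrite -(ler_pM2l MR) -(lerD2l (\sum_(1 <= q < M) u q)).
apply: le_trans (le N); apply: le_trans hN _.
have NM : (N <= M * N.+1)%N by nia.
case: N {le} NM => [|N] NM.
  rewrite [leLHS]big_geq// big_nat_cond sumr_ge0// => q /andP[/andP[q1 _] _]; exact: u0.
rewrite [leRHS](@big_cat_nat _ _ _ N.+1 1 _)//= lerDl big_nat_cond sumr_ge0//.
by move=> q /andP[/andP[mq _] _]; apply: u0; exact: leq_trans mq.
Qed.

(** If [psi] drops below [tau] it stays there, and truncation alters only finitely many terms;
    otherwise the truncated sequence is constantly [tau]. *)
Lemma unbounded_minr psi d (tau : R) : 0 < tau ->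
  (forall n, (0 < n)%N -> 0 < psi n) ->
  (forall p q, (0 < p)%N -> (p <= q)%N -> psi q <= psi p) ->
  (forall C, exists N, C <= \sum_(1 <= n < N) psi n ^+ d) ->
  forall C, exists N, C <= \sum_(1 <= n < N) Num.min (psi n) tau ^+ d.
Proof.
move=> tau0 psi0 psiM div C.
have [[n0 [n00 small]]|/forallNP big] :=
    pselect (exists n, (0 < n)%N /\ psi n < tau).
  have [N hN] := div (\sum_(1 <= n < n0) psi n ^+ d + C).
  exists (maxn n0 N).
  have big n : (n0 <= n)%N -> Num.min (psi n) tau = psi n.
    by move=> n0n; apply/min_idPl/ltW; apply: le_lt_trans small; exact: psiM.
  rewrite (@big_cat_nat _ _ _ n0 1 (maxn n0 N))//= ?leq_maxl//.
  have h1 : 0 <= \sum_(1 <= n < n0) Num.min (psi n) tau ^+ d.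
    rewrite big_nat_cond sumr_ge0// => n /andP[/andP[n1 _] _].
    by rewrite exprn_ge0// le_min (ltW tau0) ltW// psi0.
  have h2 : \sum_(n0 <= n < maxn n0 N) Num.min (psi n) tau ^+ d =
            \sum_(n0 <= n < maxn n0 N) psi n ^+ d.
    rewrite big_nat_cond [RHS]big_nat_cond; apply: eq_bigr.
    by move=> n /andP[/andP[h _] _]; rewrite big.
  have h3 : \sum_(1 <= n < N) psi n ^+ d <=
      \sum_(1 <= n < n0) psi n ^+ d + \sum_(n0 <= n < maxn n0 N) psi n ^+ d.
    rewrite -(@big_cat_nat _ _ _ n0 1 (maxn n0 N))//= ?leq_maxl//.
    have [->|N0] := posnP N.
      rewrite [leLHS]big_geq// big_nat_cond sumr_ge0// => q /andP[/andP[q1 _] _].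
      by rewrite exprn_ge0// ltW// psi0.
    rewrite [leRHS](@big_cat_nat _ _ _ N 1 _)//= ?leq_maxr// lerDl.
    rewrite big_nat_cond sumr_ge0//.
    move=> q /andP[/andP[mq _] _]; rewrite exprn_ge0// ltW// psi0//.
    exact: leq_trans mq.
  by rewrite h2; lra.
have td : 0 < tau ^+ d by rewrite exprn_gt0.
exists (Num.truncn (C / tau ^+ d)).+2.
apply: (@le_trans _ _ (\sum_(1 <= n < (Num.truncn (C / tau ^+ d)).+2) tau ^+ d)).
  rewrite sumr_const_nat subn1/= -mulr_natl -ler_pdivrMr//.
  by apply: ltW; exact: truncnS_gt.
rewrite big_nat_cond [leRHS]big_nat_cond; apply: ler_sum => n /andP[/andP[n1 _] _].
suff -> : Num.min (psi n) tau = tau by [].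
by apply/min_idPr; rewrite leNgt; apply/negP => lt; apply: (big n).
Qed.

End divergence.

(** * Sets of points missed by all large denominators *)

Section approximation_sets.
Context {R : realType}.

Lemma dist_Zd_lt d (v : 'rV[R]_d) (delta : R) : (0 < d)%N ->
  (forall i, int_near delta (v ord0 i)) -> dist_Zd v < delta.
Proof.
move=> d0 near.
have P i : exists p : int, `|v ord0 i - p%:~R| < delta.
  by apply/asboolP; exact: near.
have [p pP] := choice P.
have lt : `|v - map_mx intr (\row_i p i)| < delta.
  (* The sup norm is a maximum started at [0], so [0 < delta] has to be checked too; any one
     coordinate gives it. *)
  have delta0 : 0 < delta by apply: le_lt_trans (pP (Ordinal d0)).
  rewrite -[X in X < _]/(mx_norm _) mx_normrE; apply/bigmax_ltP; split => // -[i j] _ /=.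
  by rewrite !mxE (ord1 i).
apply: le_lt_trans lt; rewrite /dist_Zd; apply: ge_inf.
  by exists 0 => _ [q _ <-].
by exists (\row_i p i).
Qed.

Lemma measurable_int_near (delta q : R) :
  measurable [set z : R | int_near delta (q * z)].
Proof.
rewrite (_ : mkset _ = \bigcup_(p : int)
    ((fun z => `|q * z - p%:~R|) @^-1` `]-oo, delta[%classic)); last first.
  apply/seteqP; split => z.
    by move=> /asboolP[p h]; exists p => //=; rewrite in_itv.
  by move=> [p _ /=]; rewrite in_itv/= => h; apply/asboolP; exists p.
apply: countable_bigcupT_measurable => // p.
have mf : measurable_fun [set: R] (fun z : R => `|q * z - p%:~R|).
  apply: measurableT_comp => //.
  by apply: measurable_realfun.measurable_funB => //;
    exact: measurable_realfun.measurable_funM.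
by rewrite -[X in measurable X]setTI; exact: mf.
Qed.

Context {d k : nat} (A : coord_subspace R d k) (psi : nat -> R).

Definition hit_set (q : nat) : set (k.-tuple R) :=
  [set t | forall i, int_near (psi q) (q%:R * tnth (coord_param A t) i)].

Definition miss_set (m : nat) : set (k.-tuple R) :=
  [set t | forall q, (m <= q)%N -> (0 < q)%N -> ~ hit_set q t].

Definition near_box (q : nat) : set (d.-tuple R) :=
  [set y | forall i, int_near (psi q) (q%:R * tnth y i)].

Lemma measurable_near_box q : measurable (near_box q).
Proof.
rewrite (_ : near_box q = \bigcap_(i in [set: 'I_d])
    ((@tnth d R ^~ i) @^-1` [set z : R | int_near (psi q) (q%:R * z)])); last first.
  by apply/seteqP; split => [y h i _|y h i]; exact: h.
apply: (@fin_bigcap_measurable _ (d.-tuple R : measurableType _)) => // i _.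
rewrite -[X in measurable X]setTI; apply: measurable_tnth => //.
exact: measurable_int_near.
Qed.

(** The exceptional sets live in [R^d], where [coord_lebesgue A] is a measure; [miss_setE] pulls
    them back to the parameter space, where the estimates take place. *)
Definition miss_box (m : nat) : set (d.-tuple R) :=
  \bigcap_(q in [set q | (m <= q)%N && (0 < q)%N]) ~` near_box q.

Lemma measurable_miss_box m : measurable (miss_box m).
Proof.
apply: bigcap_measurable => [|q _]; last first.
  by apply: measurableC; exact: measurable_near_box.
by exists (maxn m 1); rewrite /= leq_maxl leq_maxr.
Qed.

Lemma miss_setE m : miss_set m = coord_param A @^-1` miss_box m.
Proof.
apply/seteqP; split => t h q; first by move=> /andP[h1 h2]; exact: h.
by move=> h1 h2; apply: h; rewrite /= h1.
Qed.

Lemma measurable_miss_set m : measurable (miss_set m).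
Proof.
rewrite miss_setE -[X in measurable X]setTI.
by apply: measurable_coord_param => //; exact: measurable_miss_box.
Qed.

Lemma tnth_coord_paramB (t u : k.-tuple R) (e : R) : 0 < e ->
  (forall j, `|tnth t j - tnth u j| < e) ->
  forall i, `|tnth (coord_param A t) i - tnth (coord_param A u) i| < e.
Proof.
move=> e0 h i; rewrite !tnth_mktuple; case: ifPn => iA.
  by rewrite subrr normr0.
have ik : (index i (enum (~: fixed A)%SET) < k)%N.
  by rewrite -{2}(card_free A) cardE index_mem mem_enum inE.
by have := h (Ordinal ik); rewrite !(tnth_nth 0).
Qed.

Lemma closed_miss_set m y : ~ miss_set m y ->
  exists2 e : R, 0 < e &
    forall z, (forall i, `|tnth z i - tnth y i| < e) -> ~ miss_set m z.
Proof.
move=> /existsNP[q /not_implyP[mq /not_implyP[q0 /contrapT hq]]].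
have P i : exists p : int, `|q%:R * tnth (coord_param A y) i - p%:~R| < psi q.
  by apply/asboolP; exact: hq.
have [p pP] := choice P.
have qR : 0 < q%:R :> R by rewrite ltr0n.
(* Moving a coordinate by less than [e] moves its [q]-fold by less than [q * e], so the slack in
   each of the finitely many strict inequalities is divided by [q]. *)
pose r i := (psi q - `|q%:R * tnth (coord_param A y) i - (p i)%:~R|) / q%:R.
have e0 : 0 < \big[Num.min/1]_i r i.
  by apply/bigmin_gtP; split => // i _; rewrite divr_gt0// subr_gt0.
exists (\big[Num.min/1]_i r i) => //; set e := \big[_/_]_i _ in e0 * => z zy.
move=> /(_ q mq q0); apply => i; apply/asboolP; exists (p i).
have zyi := tnth_coord_paramB e0 zy i.
have er : e <= r i by exact: bigmin_le.
set a := tnth (coord_param A z) i in zyi *; set b := tnth (coord_param A y) i in zyi.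
have -> : q%:R * a - (p i)%:~R = q%:R * (a - b) + (q%:R * b - (p i)%:~R) by ring.
apply: le_lt_trans (ler_normD _ _) _; rewrite -ltrBrDr normrM (gtr0_norm qR) mulrC.
by rewrite -ltr_pdivlMr//; exact: lt_le_trans er.
Qed.

End approximation_sets.

(** * The local estimate and the null sets *)

Section khintchine.
Context {R : realType} {d k : nat} (A : coord_subspace R d k) (psi : nat -> R).
Context (k2 : (2 <= k)%N).
Context (psi0 : forall q, (0 < q)%N -> 0 < psi q).
Context (psiM : forall p q, (0 < p)%N -> (p <= q)%N -> psi q <= psi p).
Context (psidiv : ~ cvgn (fun n => \sum_(1 <= q < n) psi q ^+ d)).

(* Only the denominators [M * n] are used in a cube of side [1 / M] with corner
   in [1 / M] times the integer lattice: after rescaling, the local problem is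
   the global one for [n |-> psi (M * n)] and the fixed coordinates times [M]. *)
Lemma miss_set_cube_le m M (c : 'I_k -> int) : (0 < m)%N -> (0 < M)%N ->
  (lebesgue_tuple k (miss_set A psi m `&`
     cube (fun i => (c i)%:~R * M%:R^-1)%R (M%:R^-1)%R) <=
   ((1 - hit k / 8) * M%:R^-1 ^+ k)%:E)%E.
Proof.
move=> m0 M0.
have MR : 0 < M%:R :> R by rewrite ltr0n.
set v : R := M%:R^-1; have v0 : 0 < v by rewrite invr_gt0.
set C := cube _ v.
(* Truncating at [hit k] meets the size limit of the covering argument and keeps [a n <= 1]. *)
pose a n := Num.min (psi (M * n)%N) (hit k).
pose I := {i : 'I_d | i \in fixed A}.
pose x (i : I) := M%:R * fixed_value A (val i).
pose Q n := [forall i, int_near (a n) (n%:R * x i)].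
have Mn n : (0 < n)%N -> (0 < M * n)%N by move=> n0; rewrite muln_gt0 M0.
have a0 n : (0 < n)%N -> 0 < a n by move=> n0; rewrite lt_min psi0 ?hit_gt0// Mn.
have ah n : a n <= hit k by rewrite ge_min lexx orbT.
have Id : (#|{: I}| + k)%N = d by rewrite card_sig; exact: fixed_card.
have aM p q : (0 < p)%N -> (p <= q)%N -> a q <= a p.
  move=> p0 pq; rewrite /a le_min !ge_min lexx orbT andbT.
  by rewrite psiM ?Mn// leq_mul.
have diva : forall B, exists N, B <= \sum_(1 <= n < N) a n ^+ (#|{: I}| + k).
  rewrite Id; apply: unbounded_minr; first exact: hit_gt0.
  - by move=> n n0; rewrite psi0// Mn.
  - by move=> p q p0 pq; rewrite psiM ?Mn ?leq_mul.
  apply: (unbounded_dilate (u := fun q => psi q ^+ d)) => //.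
  - by move=> n n0; rewrite exprn_ge0// ltW// psi0.
  - move=> p q p0 pq; rewrite lerXn2r ?nnegrE ?psiM// ltW// psi0//.
    exact: leq_trans pq.
  apply: unbounded_of_Ncvgn psidiv => n n0.
  by rewrite exprn_ge0// ltW// psi0.
have divQ := divergence_near x (ltnW k2) (fun n n0 =>
  introT andP (conj (a0 n n0) (le_trans (ah n) (hit_le1 k)))) aM diva.
have [N hN] := lebesgue_primitive_union_ge (fun i => (c i)%:~R) k2 v0 m0
  (fun n n0 => introT andP (conj (ltW (a0 n n0)) (ah n))) divQ.
set U := \big[setU/set0]_(n <- _) _ in hN.
have UC : U `<=` C `\` miss_set A psi m.
  rewrite /U -bigcup_seq => t [n /=].
  rewrite mem_filter mem_index_iota => /andP[/forallP Qn /andP[mn _]].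
  move=> /primitive_cubesP[s _ ts].
  have n0 : (0 < n)%N by exact: leq_trans mn.
  have nR : 0 < n%:R :> R by rewrite ltr0n.
  have a1 : a n <= 1 := le_trans (ah n) (hit_le1 k).
  have st j : (c j)%:~R * v + (s j)%:R / n%:R * v <= tnth t j <
      (c j)%:~R * v + (s j)%:R / n%:R * v + a n / n%:R * v.
    by have := ts j; rewrite mulrDl.
  (* As [s j + 1 <= n] and [a n <= 1], the small cube stays inside [C]. *)
  have sn j : (s j)%:R / n%:R + a n / n%:R <= 1.
    rewrite -mulrDl ler_pdivrMr// mul1r.
    have : (s j)%:R + 1 <= n%:R :> R by rewrite natr1 ler_nat.
    lra.
  split.
    move=> j; have /andP[h1 h2] := st j; apply/andP; split.
      apply: le_trans h1; rewrite lerDl mulr_ge0 ?divr_ge0// ltW//.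
    apply: lt_le_trans h2 _; rewrite -addrA lerD2l -mulrDl ler_piMl ?sn// ltW//.
  move=> /(_ (M * n)%N); apply; [|exact: Mn|].
    by apply: leq_trans mn _; rewrite leq_pmull.
  have apsi : a n <= psi (M * n)%N by rewrite ge_min lexx.
  (* For a fixed coordinate, [M * n] times its value is [n * x], and [Q n] applies. A free
     coordinate times [M * n] lies within [a n] to the right of the integer [c j * n + s j]. *)
  move=> i; apply: int_near_le apsi _.
  rewrite tnth_mktuple; case: ifPn => [iA|iA].
    have := Qn (exist _ i iA); rewrite /x /= natrM.
    by rewrite mulrA [n%:R * _]mulrC.
  have ik : (index i (enum (~: fixed A)%SET) < k)%N.
    by rewrite -{2}(card_free A) cardE index_mem mem_enum inE.
  pose j := Ordinal ik.
  rewrite (_ : nth 0 t _ = tnth t j); last by rewrite (tnth_nth 0).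
  apply/asboolP; exists (c j * n%:Z + (s j)%:Z).
  have /andP[h1 h2] := st j.
  have Mn0 : 0 < M%:R * n%:R :> R by rewrite mulr_gt0.
  rewrite -(ler_pM2r Mn0) in h1; rewrite -(ltr_pM2r Mn0) in h2.
  have e1 : ((c j)%:~R * v + (s j)%:R / n%:R * v) * (M%:R * n%:R) =
      (c j)%:~R * n%:R + (s j)%:R.
    by rewrite /v; field; rewrite !gt_eqF.
  have e2 : a n / n%:R * v * (M%:R * n%:R) = a n.
    by rewrite /v; field; rewrite !gt_eqF.
  rewrite mulrDl e1 e2 in h2; rewrite e1 in h1.
  rewrite natrM intrD intrM -!pmulrn.
  by rewrite ltr_norml; apply/andP; split; have := a0 n n0; lra.
have mC : measurable C by exact: measurable_cube.
have mF := measurable_miss_set A psi m.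
have CE : (lebesgue_tuple k (C `\` miss_set A psi m) +
    lebesgue_tuple k (miss_set A psi m `&` C) = (v ^+ k)%:E)%E.
  by rewrite [miss_set _ _ _ `&` _]setIC -measureDI//; apply: lebesgue_cube; exact: ltW.
have UD : ((hit k / 8 * v ^+ k)%:E <= lebesgue_tuple k (C `\` miss_set A psi m))%E.
  apply: le_trans hN _; apply: le_measure; rewrite ?inE//; last exact: measurableD.
  by apply: bigsetU_measurable => n _; exact: measurable_primitive_cubes.
have X0 : (0 <= lebesgue_tuple k (miss_set A psi m `&` C))%E by exact: measure_ge0.
move: CE UD X0; case: (lebesgue_tuple k (_ `\` _)) => [y| |]//;
  case: (lebesgue_tuple k (_ `&` _)) => [z| |]//.
by rewrite -EFinD !lee_fin => -[h1] h2 h3; lra.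
Qed.

Lemma miss_set_null m : lebesgue_tuple k (miss_set A psi m) = 0%E.
Proof.
(* The local estimate is for positive [m]; [miss_set] increases with [m], which covers [m = 0]. *)
suff null m' : (0 < m')%N -> lebesgue_tuple k (miss_set A psi m') = 0%E.
  have sub : miss_set A psi m `<=` miss_set A psi m.+1.
    by move=> t h q mq; apply: h; exact: ltnW.
  apply/eqP; rewrite -measure_le0 -(null m.+1)//.
  by apply: le_measure; rewrite ?inE//; exact: measurable_miss_set.
move=> m0; apply: (@null_of_dyadic _ _ _ (hit k / 8)).
- by have := hit_gt0 (R := R) k; have := hit_le1 (R := R) k => *; apply/andP; split; lra.
- exact: measurable_miss_set.
- exact: closed_miss_set.
move=> j c; have := @miss_set_cube_le m' (2 ^ j) c m0.
by rewrite expn_gt0 natrX => /(_ isT).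
Qed.

End khintchine.

Theorem theorem1p1 (R : realType) (d k : nat) (A : coord_subspace R d k) :
  (2 <= d)%N -> (2 <= k)%N -> khintchine_type_divergence A.
Proof.
move=> d2 k2 psi psi0 psiM psidiv.
apply: (@negligibleS _ _ _ (coord_lebesgue A) (\bigcup_m miss_box (d := d) psi m)).
  move=> y /not_implyP[_ ny]; apply: contrapT => yB; apply: ny.
  (* Outside every [miss_box] there are hits beyond any bound; were the approximating [q] finite in
     number, a hit past their maximum would be a contradiction. *)
  have hit m : exists q, [/\ (m <= q)%N, (0 < q)%N & near_box psi q y].
    apply: contrapT => h; apply: yB; exists m => // q /andP[mq q0] yq.
    by apply: h; exists q.
  move=> /finite_seqP[S SE].
  have [q [mq q0 yq]] := hit (\max_(i <- S) i).+1.
  have : [set` S] q.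
    rewrite -SE; split => //; apply: dist_Zd_lt; first exact: ltnW.
    by move=> i; rewrite !mxE.
  move=> /= qS; have := @leq_bigmax_seq _ (S) xpredT id q qS isT.
  by rewrite leqNgt mq.
apply: negligible_bigcup => m; apply/negligibleP.
  exact: measurable_miss_box.
(* [coord_lebesgue A] is a pushforward, so this holds by unfolding. *)
rewrite -[LHS]/(lebesgue_tuple k (coord_param A @^-1` miss_box psi m)).
by rewrite -miss_setE; exact: miss_set_null.
Qed.
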